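(* (1) Suppose there are constants $c_1,k_1>0$ such that for every $n\ge2$, every Boolean function $f:\{0,1\}^n\to\{0,1\}$ and every bi-partition of the input indices $[n]$ between two parties, $\mathsf{CC}(f)\le c_1\deg(f)^2(\log n)^{k_1}$. Then there are constants $c_2,k_2>0$ such that for every $n\ge 2$ and every $f:\{0,1\}^n\to\{0,1\}$, $\mathrm{D}(f)\le c_2\deg(f)^2(\log n)^{k_2}$. (2) Suppose there are constants $c_1,k_1>0$ such that for every $n\ge2$, every Boolean function $f:\{0,1\}^n\to\{0,1\}$ and every bi-partition of $[n]$, $\mathsf{CC}(f)\le c_1\mathrm{bs}(f)^2(\log n)^{k_1}$. Then there are constants $c_2,k_2>0$ such that for every $n\ge2$ and every $f:\{0,1\}^n\to\{0,1\}$, $\mathrm{D}(f)\le c_2\mathrm{fbs}(f)^2(\log n)^{k_2}$.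
   Context: Logarithms are base 2. Given a bi-partition of $[n]$ into $S_1,S_2$, Alice holds the bits of $x$ indexed by $S_1$ and Bob those indexed by $S_2$; $\mathsf{CC}(f)$ (with respect to that bi-partition) is the minimum, over deterministic two-party communication protocols that correctly compute $f(x)$ on every input, of the maximum number of bits exchanged. $\mathrm{D}(f)$ is the minimum depth of a deterministic decision tree (querying single input bits) computing $f$. $\deg(f)$ is the degree of the unique multilinear real polynomial agreeing with $f$ on $\{0,1\}^n$. For $B\subseteq[n]$, $x^{\oplus B}$ is $x$ with bits in $B$ flipped; $B$ is a sensitive block of $x$ if $f(x^{\oplus B})\ne f(x)$; $\mathrm{bs}(f)=\max_x$ (maximum number of pairwise disjoint sensitive blocks of $x$). $\mathrm{fbs}(f,x)$ is the maximum of $\sum_B w_B$ over weights $w_B\in[0,1]$ on the sensitive blocks $B$ of $x$ subject to $\sum_{B\ni i}w_B\le 1$ for every $i\in[n]$; $\mathrm{fbs}(f)=\max_x\mathrm{fbs}(f,x)$. *)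

(* Defs.v *)
From HB Require Import structures.
From mathcomp Require Import all_boot all_order all_algebra.
From mathcomp Require Import boolp classical_sets reals exp mpoly.

Set Implicit Arguments.
Unset Strict Implicit.
Unset Printing Implicit Defensive.

Import Order.TTheory GRing.Theory Num.Theory.
Local Open Scope ring_scope.

Definition log2 {R : realType} (n : nat) : R := ln n%:R / ln 2.

Notation input n := {ffun 'I_n -> bool}.
Notation boolfun n := (input n -> bool).

Inductive dtree (n : nat) : Type :=
| DLeaf of bool
| DQuery of 'I_n & dtree n & dtree n.
Arguments DLeaf {n}.

Fixpoint dt_eval n (t : dtree n) (x : input n) : bool :=
  match t with
  | DLeaf b => b
  | DQuery i t0 t1 => if x i then dt_eval t1 x else dt_eval t0 x
  end.

Fixpoint dt_depth n (t : dtree n) : nat :=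
  match t with
  | DLeaf _ => 0
  | DQuery _ t0 t1 => (maxn (dt_depth t0) (dt_depth t1)).+1
  end.

Definition dt_computes n (t : dtree n) (f : boolfun n) : Prop :=
  forall x, dt_eval t x = f x.

Lemma dt_exists n (f : boolfun n) : exists t : dtree n, dt_computes t f.
Proof.
suff H (s : seq 'I_n) : forall g : boolfun n,
    (forall x y : input n, {in s, x =1 y} -> g x = g y) ->
    exists t : dtree n, dt_computes t g.
  apply: (H (enum 'I_n)) => x y xy; congr f; apply/ffunP => i.
  by apply: xy; rewrite mem_enum.
elim: s => [|i s IH] g gP.
  by exists (DLeaf (g [ffun=> false])) => x /=; apply: gP.
pose upd b (x : input n) : input n := [ffun j => if j == i then b else x j].
have updP b : exists t : dtree n, dt_computes t (g \o upd b).
  apply: IH => x y xy /=; apply: gP => j; rewrite inE !ffunE.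
  by case: eqP => //= _ /xy.
have [[t0 t0P] [t1 t1P]] := (updP false, updP true).
exists (DQuery i t0 t1) => x /=.
by case E: (x i); rewrite ?t0P ?t1P /=; congr g; apply/ffunP => j;
  rewrite ffunE; case: eqP => // ->.
Qed.

Lemma D_exists n (f : boolfun n) :
  exists d, `[< exists t : dtree n, dt_computes t f /\ dt_depth t = d >].
Proof. by have [t tP] := dt_exists f; exists (dt_depth t); apply/asboolP; exists t. Qed.

Definition D n (f : boolfun n) : nat := ex_minn (D_exists f).

(** [X] and [Y] are the parties' private inputs. A leaf
    carries the common output; at every other node the designated party sends
    the bit that the node's function assigns to its own input. *)

Inductive protocol (X Y : Type) : Type :=
| PLeaf of bool
| PAlice of (X -> bool) & protocol X Y & protocol X Y
| PBob of (Y -> bool) & protocol X Y & protocol X Y.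
Arguments PLeaf {X Y}.

Fixpoint p_out X Y (p : protocol X Y) (u : X) (v : Y) : bool :=
  match p with
  | PLeaf b => b
  | PAlice a p0 p1 => if a u then p_out p1 u v else p_out p0 u v
  | PBob b p0 p1 => if b v then p_out p1 u v else p_out p0 u v
  end.

Fixpoint p_bits X Y (p : protocol X Y) (u : X) (v : Y) : nat :=
  match p with
  | PLeaf _ => 0
  | PAlice a p0 p1 => (if a u then p_bits p1 u v else p_bits p0 u v).+1
  | PBob b p0 p1 => (if b v then p_bits p1 u v else p_bits p0 u v).+1
  end.

Notation part S := {ffun {i | i \in S} -> bool}.

Definition restr n (S : {set 'I_n}) (x : input n) : part S :=
  [ffun i => x (val i)].

(** The bi-partition is ([S], [~: S]), with Alice holding [S]. *)
Definition p_computes n (S : {set 'I_n})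
    (p : protocol (part S) (part (~: S))) (f : boolfun n) : Prop :=
  forall x, p_out p (restr S x) (restr (~: S) x) = f x.

Definition p_cost n (S : {set 'I_n})
    (p : protocol (part S) (part (~: S))) : nat :=
  \max_(x : input n) p_bits p (restr S x) (restr (~: S) x).

Lemma p_exists n (f : boolfun n) (S : {set 'I_n}) :
  exists p : protocol (part S) (part (~: S)), p_computes p f.
Proof.
pose join (u : part S) (v : part (~: S)) : input n :=
  [ffun i => if insub i is Some j then u j
             else if insub i is Some k then v k else false].
have joinK x : join (restr S x) (restr (~: S) x) = x.
  apply/ffunP => i; rewrite ffunE; case: insubP => [j _ ji|iS].
    by rewrite ffunE /= ji.
  case: insubP => [j _ ji|]; first by rewrite ffunE /= ji.
  by rewrite finset.in_setC (negPf iS).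
suff H (s : seq (part S)) : exists p : protocol (part S) (part (~: S)),
    {in s, forall u v, p_out p u v = f (join u v)}.
  have [p pP] := H (enum (part S)).
  by exists p => x; rewrite pP ?mem_enum // joinK.
elim: s => [|u s [p IH]]; first by exists (PLeaf false).
exists (PAlice (pred1 u) p (PBob (fun v => f (join u v)) (PLeaf false) (PLeaf true))).
move=> w; rewrite inE /= => /orP[/eqP -> v|/IH ws v].
  by rewrite eqxx; case: (f _).
by case: eqP => [->|_]; [case: (f _) | exact: ws].
Qed.

Lemma CC_exists n (f : boolfun n) (S : {set 'I_n}) :
  exists c, `[< exists p : protocol (part S) (part (~: S)),
                  p_computes p f /\ p_cost p = c >].
Proof.
by have [p pP] := p_exists f S; exists (p_cost p); apply/asboolP; exists p.
Qed.

Definition CC n (f : boolfun n) (S : {set 'I_n}) : nat :=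
  ex_minn (CC_exists f S).

Definition multilinear (R : realType) n (p : {mpoly R[n]}) : Prop :=
  forall m, m \in msupp p -> forall i, (m i <= 1)%N.

Definition agrees (R : realType) n (p : {mpoly R[n]}) (f : boolfun n) : Prop :=
  forall x : input n, p.@[fun i => (x i)%:R] = (f x)%:R.

Lemma mlpoly_exists (R : realType) n (f : boolfun n) :
  exists p : {mpoly R[n]}, multilinear p /\ agrees p f.
Proof.
pose ml (s : seq 'I_n) (p : {mpoly R[n]}) :=
  forall m, m \in msupp p -> forall i, (m i <= (i \in s))%N.
suff H (s : seq 'I_n) : uniq s -> forall g : boolfun n,
    (forall x y : input n, {in s, x =1 y} -> g x = g y) ->
    exists p : {mpoly R[n]}, ml s p /\ agrees p g.
  have [x y xy|p [pml pf]] := H (enum 'I_n) (enum_uniq _) f.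
    by congr f; apply/ffunP => i; apply: xy; rewrite mem_enum.
  by exists p; split=> // m mp i; apply: leq_trans (pml _ mp i) (leq_b1 _).
elim: s => [_|i s IH /= /andP[is_ us]] g gP.
  exists (g [ffun=> false])%:R%:MP; split=> [m|x].
    rewrite msuppC; case: ifP => // _; rewrite inE => /eqP -> j.
    by rewrite mnm0E.
  by rewrite mevalC; congr (nat_of_bool _)%:R; apply: gP.
pose upd b (x : input n) : input n := [ffun j => if j == i then b else x j].
have updP b : exists p : {mpoly R[n]}, ml s p /\ agrees p (g \o upd b).
  apply: IH => // x y xy /=; apply: gP => j; rewrite inE !ffunE.
  by case: eqP => //= _ /xy.
have [[p0 [ml0 p0P]] [p1 [ml1 p1P]]] := (updP false, updP true).
have mlB : ml s (p1 - p0).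
  move=> m /msuppB_le; rewrite mem_cat => /orP[/ml1|/ml0]; exact.
exists (p0 + (p1 - p0) * 'X_i); split=> [m /msuppD_le|x].
  rewrite mem_cat => /orP[m0 j|].
    by apply: leq_trans (ml0 _ m0 j) _; rewrite inE; case: (j \in s); rewrite ?orbT.
  move=> /msuppM_le /allpairsP[[m1 m2] /= [/mlB m1P]].
  rewrite msuppX inE => /eqP -> -> j; rewrite mnmDE mnm1E inE eq_sym.
  have := m1P j; case: (eqVneq i j) => [<-|_] /=; last by rewrite addn0.
  by rewrite (negPf is_) leqn0 => /eqP ->.
rewrite mevalD mevalM mevalB mevalXU p0P p1P /=.
have updx : upd (x i) x = x.
  by apply/ffunP => j; rewrite ffunE; case: eqP => // ->.
by case: (x i) updx => ->; rewrite ?mulr1 ?mulr0 ?addr0 // addrC subrK.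
Qed.

Lemma mlpoly_unique (R : realType) n (f : boolfun n) (p q : {mpoly R[n]}) :
  multilinear p -> agrees p f -> multilinear q -> agrees q f -> p = q.
Proof.
move=> mlp pf mlq qf; apply/eqP; rewrite -subr_eq0; set r := p - q.
have mlr : multilinear r.
  by move=> m /msuppB_le; rewrite mem_cat => /orP[/mlp|/mlq]; exact.
have r0 (x : input n) : r.@[fun i => (x i)%:R] = 0.
  by rewrite mevalB pf qf subrr.
suff H k : forall m, (mdeg m < k)%N -> r@_m = 0.
  by apply/eqP/mpolyP => m; rewrite mcoeff0 (H (mdeg m).+1).
elim: k => // k IH m mk; apply/eqP; rewrite mcoeff_eq0; apply/negP => mr.
have := r0 [ffun i => m i != 0%N]; rewrite mevalE (bigD1_seq m) ?msupp_uniq //=.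
rewrite [X in _ * X]big1 => [|i _]; last first.
  by rewrite ffunE; case: (m i) => [|k']; rewrite ?expr0 ?expr1n.
rewrite mulr1 big_seq_cond big1 ?addr0 => [/eqP|m' /andP[m'r m'm]].
  by rewrite mcoeff_eq0 mr.
have [/existsP[i /andP[mi m'i]]|/existsPn m'le] :=
    boolP [exists i, (m i == 0%N) && (m' i != 0%N)].
  by rewrite (bigD1 i) //= ffunE mi expr0n (negPf m'i) mul0r mulr0.
have le i : (m' i <= m i)%N.
  have := m'le i; have := mlr _ m'r i.
  by case: (m i) (m' i) => [|a] [|[|b]].
rewrite IH ?mul0r //; apply: leq_trans (mk : (_ <= k)%N).
rewrite !mdegE ltn_neqAle leq_sum // andbT; apply: contraNneq m'm => E.
have /leqif_sum/= Hs : forall i, true -> (m' i <= m i ?= iff (m' i == m i))%N.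
  by move=> i _; apply/leqif_eq/le.
by apply/eqP/mnmP => i; move: Hs.2; rewrite E eqxx => /esym/forallP/(_ i)/eqP.
Qed.

Definition mlpoly (R : realType) n (f : boolfun n) : {mpoly R[n]} :=
  sval (cid (mlpoly_exists R f)).

(** [msize] is one more than the total degree, so constants, including the zero
    function, get degree 0. *)
Definition deg (R : realType) n (f : boolfun n) : nat :=
  (msize (mlpoly R f)).-1.

Definition flip n (x : input n) (B : {set 'I_n}) : input n :=
  [ffun i => x i (+) (i \in B)].

Definition sensitive n (f : boolfun n) (x : input n) (B : {set 'I_n}) : bool :=
  f (flip x B) != f x.

Definition bs n (f : boolfun n) : nat :=
  \max_(x : input n)
    \max_(P : {set {set 'I_n}} | finset.trivIset P && [forall B in P, sensitive f x B])
      #|P|.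

Section Fbs.
Variables (R : realType) (n : nat) (f : boolfun n).
Local Open Scope classical_set_scope.

(** Values of [w] off the sensitive blocks are irrelevant. *)
Definition fbs_feasible (x : input n) (w : {set 'I_n} -> R) : Prop :=
  (forall B, sensitive f x B -> 0 <= w B <= 1) /\
  (forall i, \sum_(B : {set 'I_n} | sensitive f x B && (i \in B)) w B <= 1).

Definition fbs_values (x : input n) : set R :=
  [set \sum_(B : {set 'I_n} | sensitive f x B) w B | w in fbs_feasible x].

(** The set of values is the image of a compact polytope under a linear map, so
    the supremum is a maximum. *)
Definition fbs_at (x : input n) : R := sup (fbs_values x).

Lemma fbs_has_sup x : has_sup (fbs_values x).
Proof.
split.
  exists 0, (fun=> 0); last by rewrite big1.
  by split=> [B _|i]; rewrite ?lexx ?ler01 // big1 // ler01.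
exists (\sum_(B : {set 'I_n} | sensitive f x B) 1) => _ [w [w01 _] <-].
by apply: ler_sum => B /w01/andP[].
Qed.

Lemma fbs_at_ge0 x : 0 <= fbs_at x.
Proof.
apply: (ub_le_sup (fbs_has_sup x).2); exists (fun=> 0); last by rewrite big1.
by split=> [B _|i]; rewrite ?lexx ?ler01 // big1 // ler01.
Qed.

(** The default value 0 of the iterated maximum is harmless by [fbs_at_ge0]. *)
Definition fbs : R := \big[Num.max/0]_(x : input n) fbs_at x.

End Fbs.

(* Main.v *)
(** Lifting by the indexing gadget. Let F be the composition of f with n copies
    of the gadget Ind(a, y) = y_a, where Alice holds the addresses (q = O(log n)
    bits each) and Bob the tables (2^q = poly(n) bits each). A protocol for F is
    simulated by a decision tree for f with at most as many queries as bits
    (Raz-McKenzie). The tree maintains a rectangle A x B of gadget inputs such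
    that every line of A in every direction is dense or empty and B is not too
    small. A bit of the protocol at worst halves A or B, and by removing sparse
    lines A becomes thick again. When the shadow of A in some direction i is
    eight times larger than A, the tree queries the i-th bit of f and replaces A
    by that shadow: since lines of A are dense and B is large, there is a small
    set U of addresses that meets every line of A in direction i, while many
    tables in B give the queried value on all of U. Eightfold growth of the
    density of A pays for the query.

    Thus D(f) <= CC(F). Since Ind has degree and certificate size at most q + 1,
    deg(F) <= (q + 1) deg(f) and bs(F) <= (q + 1) fbs(f), and F has poly(n)
    variables, so a bound on CC(F) gives the bound on D(f). *)

Require Import Defs.
From HB Require Import structures.
From mathcomp Require Import all_boot all_order all_algebra.
From mathcomp Require Import zify ring.
From mathcomp Require Import boolp reals exp mpoly.

Set Implicit Arguments.
Unset Strict Implicit.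
Unset Printing Implicit Defensive.

Import Order.TTheory GRing.Theory Num.Theory.

(** * Thick sets *)

Section Update.
Variables (I : finType) (V : Type).
Implicit Types (x : {ffun I -> V}) (i j : I) (v w : V).

Definition upd x i v : {ffun I -> V} := [ffun j => if j == i then v else x j].

Lemma upd_at x i v : upd x i v i = v.
Proof. by rewrite ffunE eqxx. Qed.

Lemma upd_off x i v j : j != i -> upd x i v j = x j.
Proof. by rewrite ffunE => /negPf ->. Qed.

Lemma upd_id x i : upd x i (x i) = x.
Proof. by apply/ffunP => j; rewrite ffunE; case: eqP => // ->. Qed.

Lemma upd_upd x i v w : upd (upd x i v) i w = upd x i w.
Proof. by apply/ffunP => j; rewrite !ffunE; case: eqP. Qed.

Lemma updC x i j v w : i != j -> upd (upd x i v) j w = upd (upd x j w) i v.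
Proof.
move=> ij; apply/ffunP => k; rewrite !ffunE.
by case: (eqVneq k j) => // ->; rewrite eq_sym (negPf ij).
Qed.

End Update.

Section Cylinders.
Variables (I T : finType).
Local Notation X := {ffun I -> T}.
Implicit Types (A : {set X}) (x : X) (i : I) (K : nat).

(** The shadow of [A] in direction [i], kept as a cylinder in the full space: no coordinate is
    removed, so the simulation stays in one type. *)
Definition cyl i A : {set X} := [set x | [exists a, upd x i a \in A]].

Definition line A i x : {set T} := [set a | upd x i a \in A].

Definition thick K A := forall x, x \in A -> forall i, #|T| <= K * #|line A i x|.

Lemma cylP i A x : reflect (exists a, upd x i a \in A) (x \in cyl i A).
Proof. by rewrite inE; apply: existsP. Qed.

Lemma sub_cyl i A : A \subset cyl i A.
Proof. by apply/fintype.subsetP => x xA; apply/cylP; exists (x i); rewrite upd_id. Qed.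

Lemma cylS i A A' : A \subset A' -> cyl i A \subset cyl i A'.
Proof.
by move=> /fintype.subsetP s; apply/fintype.subsetP => x /cylP[a /s ?]; apply/cylP; exists a.
Qed.

Lemma line_upd A i x a : line A i (upd x i a) = line A i x.
Proof. by apply/setP => b; rewrite !inE upd_upd. Qed.

Lemma sum_line A i : \sum_(x in cyl i A) #|line A i x| = #|T| * #|A|.
Proof.
have -> : \sum_(x in cyl i A) #|line A i x| = \sum_x \sum_a (upd x i a \in A : nat).
  rewrite [RHS](bigID (mem (cyl i A))) /= [X in _ + X]big1 ?addn0.
    by apply: eq_bigr => x _; rewrite -sum1_card big_mkcond; apply: eq_bigr => a _; rewrite inE.
  move=> x /negP xA; rewrite big1 // => a _; case: (boolP (_ \in A)) => // xa.
  by case: xA; apply/cylP; exists a.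
(* Exchanging [x i] with the extra letter [a] is an involution of [X * T]; it turns the double count
   into [#|T|] copies of [#|A|]. *)
rewrite pair_big /= (reindex_inj (h := fun u : X * T => (upd u.1 i u.2, u.1 i))) /=; last first.
  apply: (can_inj (g := fun u : X * T => (upd u.1 i u.2, u.1 i))) => -[x a] /=.
  by rewrite upd_upd upd_id upd_at.
rewrite -(pair_big predT predT (fun x a => (upd (upd x i a) i (x i) \in A : nat))) /=.
under eq_bigr do under eq_bigr do rewrite upd_upd upd_id.
under eq_bigr do rewrite sum_nat_const.
rewrite -big_distrr /=; congr (_ * _).
by rewrite -[RHS]sum1_card [RHS]big_mkcond; apply: eq_bigr => x _; case: (_ \in _).
Qed.

Lemma thick_cyl_line K A x i : thick K A -> x \in cyl i A -> #|T| <= K * #|line A i x|.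
Proof. by move=> tA /cylP[a /tA/(_ i)]; rewrite line_upd. Qed.

Lemma thick_card_cyl K A i : 0 < #|T| -> thick K A -> #|cyl i A| <= K * #|A|.
Proof.
move=> T0 tA; rewrite -(leq_pmul2l T0) mulnCA -(sum_line A i) mulnC -sum_nat_const big_distrr /=.
by apply: leq_sum => x /(thick_cyl_line tA).
Qed.

Lemma thick_cyl K A i : 0 < K -> thick K A -> thick K (cyl i A).
Proof.
move=> K0 tA x /cylP[a xa] j; case: (eqVneq j i) => [->|ji].
  suff -> : line (cyl i A) i x = setT by rewrite cardsT leq_pmull.
  by apply/setP => b; rewrite !inE; apply/existsP; exists a; rewrite upd_upd.
apply: leq_trans (tA _ xa j) _; rewrite leq_mul2l; apply/orP; right.
apply/subset_leq_card/fintype.subsetP => b; rewrite !inE => xb.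
by apply/existsP; exists a; rewrite updC.
Qed.

Lemma thickW K K' A : K <= K' -> thick K A -> thick K' A.
Proof. by move=> KK' tA x xA i; apply: leq_trans (tA x xA i) _; rewrite leq_mul2r KK' orbT. Qed.

Lemma thickT K : 0 < K -> thick K setT.
Proof.
move=> K0 x _ i; suff -> : line setT i x = setT by rewrite cardsT leq_pmull.
by apply/setP => a; rewrite !inE.
Qed.

(* [A'] minimises the cost [2|I|K |A \ A'| + \sum_i |cyl i A'|]: deleting a line
   with too few points would decrease it. *)
Lemma thick_subset K A : 0 < K -> 0 < #|I| ->
    (forall i, #|cyl i A| <= K * #|A|) ->
  exists A', [/\ A' \subset A, #|A| <= 2 * #|A'| & thick (2 * #|I| * K) A'].
Proof.
move=> K0 I0 cA; pose c A' := 2 * #|I| * K * #|A :\: A'| + \sum_i #|cyl i A'|.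
case: (@arg_minnP _ A (fun A' => A' \subset A) c (fintype.subxx A)) => A' sA' minA'; exists A'; split=> //.
  (* Comparison with [A] itself, whose cost is at most [#|I| K #|A|], shows that at most half of [A]
     is deleted. *)
  have := minA' _ (fintype.subxx A); rewrite /c setDv cards0 muln0 add0n => le1.
  have le2 : \sum_i #|cyl i A| <= #|I| * (K * #|A|).
    by rewrite -sum_nat_const; apply: leq_sum => i _; apply: cA.
  have le3 : #|I| * K * (2 * #|A :\: A'|) <= #|I| * K * #|A| by nia.
  have := leq_pmul2l (m := #|I| * K) (n1 := 2 * #|A :\: A'|) (n2 := #|A|).
  rewrite muln_gt0 K0 I0 le3 => /(_ isT)/esym h.
  have := cardsID A' A; rewrite (setIidPr sA'); lia.
move=> x xA' i; rewrite leqNgt; apply/negP => low.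
(* [L] is the sparse line as a subset of [X]. Deleting it adds less than [#|T|] to the first term of
   the cost and removes [#|T|] points from [cyl i A']. *)
pose L : {set X} := [set y | upd y i (x i) == x].
have LA y : upd y i (x i) == x -> y = upd x i (y i).
  by move=> /eqP <-; rewrite upd_upd upd_id.
have := minA' (A' :\: L) (subset_trans (subsetDl _ _) sA'); rewrite /c.
have -> : #|A :\: (A' :\: L)| = #|A :\: A'| + #|line A' i x|.
  rewrite -(cardsID A' (A :\: (A' :\: L))) addnC; congr (_ + _).
    congr #|pred_of_set _|; apply/setP => y; rewrite !inE.
    by case: (y \in A'); rewrite ?andbF //= andbT.
  rewrite -(card_imset (line A' i x) (f := upd x i)); last first.
    by move=> a b /ffunP/(_ i); rewrite !upd_at.
  congr #|pred_of_set _|; apply/setP => y; rewrite !inE.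
  apply/idP/imsetP => [|[a aL ->]].
    case/andP=> /andP[h yA] yA'; rewrite yA' andbT negbK in h.
    by exists (y i); rewrite ?inE -LA.
  rewrite inE in aL; rewrite aL upd_upd upd_id eqxx /= andbT.
  by move/fintype.subsetP: sA' => /(_ _ aL).
have cD : #|cyl i A'| = #|cyl i (A' :\: L)| + #|T|.
  rewrite -(cardsID L (cyl i A')) addnC; congr (_ + _).
    congr #|pred_of_set _|; apply/setP => y; rewrite !inE.
    apply/andP/existsP => [[yL /existsP[a ya]]|[a]].
      by exists a; rewrite !inE ya upd_upd yL.
    rewrite !inE upd_upd => /andP[yL ya]; split=> //; by apply/existsP; exists a.
  rewrite -cardsT -(card_imset setT (f := upd x i)); last first.
    by move=> a b /ffunP/(_ i); rewrite !upd_at.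
  congr #|pred_of_set _|; apply/setP => y; rewrite !inE.
  apply/andP/imsetP => [[_ yL]|[a _ ->]]; first by exists (y i); rewrite ?inE -?LA.
  by rewrite upd_upd upd_id eqxx; split=> //; apply/existsP; exists (x i); rewrite upd_upd upd_id.
have sD : \sum_j #|cyl j (A' :\: L)| + #|T| <= \sum_j #|cyl j A'|.
  rewrite (bigD1 i) //= [X in _ <= X](bigD1 i) //= cD addnAC leq_add2l.
  by apply: leq_sum => j _; apply/subset_leq_card/cylS/subsetDl.
rewrite mulnDr; lia.
Qed.

End Cylinders.

(** * Hitting all lines while keeping many tables *)

Lemma card_bigcup_le (J V : finType) (P : pred J) (F : J -> {set V}) :
  #|\bigcup_(j | P j) F j| <= \sum_(j | P j) #|F j|.
Proof.
elim/big_rec2: _ => [|j m U _ le]; first by rewrite cards0.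
by rewrite (leq_trans (leq_card_setU _ _).1) ?leq_add2l.
Qed.

Section Hitting.
Variables (I T : finType).
Local Notation X := {ffun I -> T}.
Local Notation Y := {ffun I -> {ffun T -> bool}}.
Implicit Types (A W : {set X}) (B : {set Y}) (x : X) (y : Y) (i : I) (b : bool).

Definition answering B i j b : {set Y} := [set y in B | y i j == b].

Definition rare B i b : {set T} :=
  [set j | #|answering B i j b| * (2 * #|T|) < #|B|].

(* At least half of [B] answers [~~ b] on all rare positions, so [B] is
   contained, up to a factor 2, in a subcube of codimension [#|rare B i b|]. *)
Lemma card_rare B i b : #|B| * 2 ^ #|rare B i b| <= 2 * #|{: Y}|.
Proof.
set J := rare B i b; pose B' := [set y in B | [forall j in J, y i j == ~~ b]].
have BB' : #|B| <= 2 * #|B'|.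
  have le1 : #|B :\: B'| <= \sum_(j in J) #|answering B i j b|.
    apply: leq_trans (card_bigcup_le _ _); apply/subset_leq_card/fintype.subsetP => y.
    rewrite !inE negb_and andb_orl; case: (boolP (y \in B)) => yB; rewrite ?andbF //= andbT negb_forall => /existsP[j].
    rewrite negb_imply => /andP[jJ yj]; apply/bigcupP; exists j; rewrite // inE yB /=.
    by move: yj; case: (y i j); case: (b).
  have le2 : \sum_(j in J) #|answering B i j b| * (2 * #|T|) <= #|T| * #|B|.
    apply: (@leq_trans (\sum_(j in J) #|B|)); last first.
      by rewrite sum_nat_const leq_mul2r max_card orbT.
    by apply: leq_sum => j; rewrite inE => /ltnW.
  have [T0|T0] := posnP #|T|.
    suff -> : B' = B by lia.
    apply/setP => y; rewrite !inE andb_idr // => _; apply/forallP => j.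
    by have := fintype0 j T0.
  have : #|T| * (2 * #|B :\: B'|) <= #|T| * #|B|.
    by apply: leq_trans le2; rewrite -big_distrl /= mulnA mulnC [#|T| * 2]mulnC leq_mul2r le1 orbT.
  have sB : B' \subset B by apply/fintype.subsetP => y; rewrite inE => /andP[].
  rewrite leq_pmul2l // => le3.
  by have := cardsID B' B; rewrite (setIidPr sB); lia.
suff le : #|B'| * 2 ^ #|J| <= #|{: Y}|.
  by apply: leq_trans (_ : 2 * #|B'| * 2 ^ #|J| <= _); rewrite ?leq_mul2r ?BB' ?orbT // -mulnA leq_mul2l.
(* For [y] in [B'], any subset of [J] may be flipped in row [i] and then read off again, since [y]
   is constant there; so [B'] times the powerset of [J] embeds in [Y]. *)
pose F (u : Y * {set T}) : Y := upd u.1 i [ffun j => u.1 i j (+) (j \in u.2)].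
pose G (z : Y) : Y * {set T} :=
  (upd z i [ffun j => if j \in J then ~~ b else z i j], [set j in J | z i j == b]).
rewrite -card_powerset -cardsX -(card_in_imset (f := F)) ?max_card //.
apply: (can_in_inj (g := G)) => -[y S]; rewrite !inE /= => /andP[/andP[_ /forallP yJ] /fintype.subsetP SJ].
have yJ' j : j \in J -> y i j = ~~ b by move=> jJ; have /implyP/(_ jJ)/eqP := yJ j.
rewrite /G /F /=; congr pair.
  apply/ffunP => k; rewrite ffunE; case: eqP => [->|/eqP ki]; last by rewrite upd_off.
  apply/ffunP => j; rewrite ffunE upd_at ffunE; case: ifP => [/yJ' -> //|jJ].
  by rewrite (contraFF (SJ j) jJ) addbF.
apply/setP => j; rewrite inE upd_at ffunE.
case: (boolP (j \in J)) => [jJ|/negP jJ] /=; last by apply/esym/negP => /SJ.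
by rewrite yJ' //; case: (b); case: (j \in S).
Qed.

(** Averaging over addresses. By [card_rare] at most [l.+1] are rare, which is at most half of the
    size [#|T| / K] guaranteed for a line of [A]. So some non-rare address hits the lines through at
    least a [1 / (2K)] fraction of [W]. *)
Lemma hitting_step K A W B i b l : 0 < K -> W \subset A -> thick K A ->
    #|{: Y}| <= #|B| * 2 ^ l -> l.+1 * (2 * K) <= #|T| ->
  exists j, #|[set x in W | upd x i j \notin A]| * (2 * K) <= #|W| * (2 * K).-1 /\
            #|B| <= #|answering B i j b| * (2 * #|T|).
Proof.
move=> K0 /fintype.subsetP WA tA Bl lT; set J := rare B i b.
have Y0 : 0 < #|{: Y}| by apply/card_gt0P; exists [ffun=> [ffun=> false]].
have B0 : 0 < #|B| by move: (leq_trans Y0 Bl); rewrite muln_gt0 => /andP[].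
have Jl : #|J| <= l.+1.
  have := leq_trans (card_rare B i b) (leq_mul (leqnn 2) Bl).
  by rewrite mulnCA -expnS leq_pmul2l // leq_exp2l.
pose hit j := #|[set x in W | upd x i j \in A]|.
have [/existsP[j /andP[jJ jh]]|none] := boolP [exists j, (j \notin J) && (#|W| <= 2 * K * hit j)].
  exists j; split; last by rewrite inE -leqNgt in jJ.
  have : #|[set x in W | upd x i j \notin A]| + hit j = #|W|.
    rewrite addnC -(cardsID [set x | upd x i j \in A] W); congr (_ + _);
    by congr #|pred_of_set _|; apply/setP => x; rewrite !inE // andbC.
  by move: jh; rewrite /hit; nia.
have {}none j : j \in ~: J -> 2 * K * hit j < #|W|.
  rewrite inE => jJ; rewrite ltnNge; apply/negP => jh.
  by case/negP: none; apply/existsP; exists j; rewrite jJ.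
have le1 : \sum_(j in ~: J) (2 * K * hit j).+1 <= #|~: J| * #|W|.
  by rewrite -sum_nat_const; apply: leq_sum => j /none.
have E : \sum_(j in ~: J) hit j = \sum_(x in W) #|line A i x :\: J|.
  have -> : \sum_(j in ~: J) hit j = \sum_(j in ~: J) \sum_(x in W) (upd x i j \in A : nat).
    apply: eq_bigr => j _; rewrite /hit -sum1_card big_mkcond [RHS]big_mkcond.
    by apply: eq_bigr => x _; rewrite !inE; case: (x \in W); case: (_ \in A).
  rewrite exchange_big; apply: eq_bigr => x _.
  rewrite -sum1_card big_mkcond [RHS]big_mkcond; apply: eq_bigr => j _.
  by rewrite [j \in ~: J]inE [j \in _ :\: _]inE [j \in line _ _ _]inE; case: (j \in J); case: (_ \in A).
have le2 : #|W| * #|T| <= 2 * K * \sum_(j in ~: J) hit j.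
  rewrite E big_distrr -sum_nat_const /=; apply: leq_sum => x xW.
  have := tA x (WA x xW) i; have := cardsID J (line A i x).
  have : #|line A i x :&: J| <= #|J| by apply/subset_leq_card/subsetIr.
  have KJ : 2 * K * #|J| <= #|T| by apply: leq_trans lT; rewrite mulnC leq_mul2r Jl orbT.
  move=> IJ LE tL; have : K * #|line A i x| <= K * #|J| + K * #|line A i x :\: J|.
    by rewrite -LE mulnDr leq_add2r leq_mul2l IJ orbT.
  move: KJ tL; clear; move: #|line A i x| #|J| #|_ :\: _| #|T| => u v w m; nia.
have : \sum_(j in ~: J) (2 * K * hit j).+1 = 2 * K * (\sum_(j in ~: J) hit j) + #|~: J|.
  rewrite big_distrr /= -sum1_card -big_split /=; by apply: eq_bigr => j _; rewrite addn1.
have := cardsC J; nia.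
Qed.

(** Greedy choice of [t] addresses: [W] shrinks to the points whose line is still missed, by a
    factor [1 - 1/(2K)] per round, and each round costs [B] at most a factor [2 #|T| = 2 ^ q.+1]. *)
Lemma hitting K q t A W B i b l : 0 < K -> #|T| = 2 ^ q -> W \subset A -> thick K A ->
    #|{: Y}| <= #|B| * 2 ^ l -> (l + t * q.+1).+1 * (2 * K) <= #|T| ->
  exists U : {set T},
    #|[set x in W | [disjoint U & line A i x]]| * (2 * K) ^ t <= #|W| * (2 * K).-1 ^ t /\
    #|B| <= #|[set y in B | [forall j in U, y i j == b]]| * 2 ^ (t * q.+1).
Proof.
move=> K0 Tq + tA; elim: t W B l => [|t IH] W B l WA Bl lT.
  exists finset.set0; split; rewrite !muln1; apply/subset_leq_card/fintype.subsetP => x.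
    by rewrite inE => /andP[].
  by rewrite inE => ->; apply/forallP => j; rewrite inE.
have lT' : l.+1 * (2 * K) <= #|T| by apply: leq_trans lT; rewrite leq_mul2r ltnS leq_addr orbT.
have [j [jW jB]] := hitting_step i b K0 WA tA Bl lT'.
have Tq' : 2 * #|T| = 2 ^ q.+1 by rewrite Tq expnS.
have [|||] := IH [set x in W | upd x i j \notin A] (answering B i j b) (l + q.+1).
- by apply/fintype.subsetP => x; rewrite inE => /andP[/(fintype.subsetP WA)].
- apply: leq_trans Bl _; rewrite expnD mulnCA [_ * 2 ^ l]mulnC leq_mul2l -Tq'.
  by rewrite jB orbT.
- by rewrite -addnA -mulSn.
move=> U [UW UB]; exists (j |: U); split.
  have -> : [set x in W | [disjoint j |: U & line A i x]] =
            [set x in [set x in W | upd x i j \notin A] | [disjoint U & line A i x]].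
    by apply/setP => x; rewrite !inE -setI_eq0 setIUl setU_eq0 !setI_eq0 disjoints1 inE andbA.
  rewrite !expnS; nia.
apply: leq_trans jB _; rewrite Tq' mulSn expnD mulnCA mulnC leq_mul2l.
apply/orP; right; apply: leq_trans UB _; rewrite leq_mul2r; apply/orP; right.
apply/subset_leq_card/fintype.subsetP => y; rewrite !inE -andbA => /and3P[-> yj /forallP yU] /=.
apply/forallP => k; apply/implyP; rewrite !inE => /orP[/eqP -> //|kU].
exact: (implyP (yU k)).
Qed.

End Hitting.

(** * Fixing one gadget value on a whole cylinder *)

Lemma bernoulli_nat a k : a ^ k * (a + k) <= a * a.+1 ^ k.
Proof.
elim: k => [|k IH]; first by rewrite !expn0; lia.
rewrite !expnS; nia.
Qed.

(** Bernoulli's inequality with [a = d - 1] and [k = d], cleared of denominators in [bernoulli_nat],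
    gives [(1 + 1/a)^d >= 2]. *)
Lemma expn_pred_half d : 0 < d -> 2 * d.-1 ^ d <= d ^ d.
Proof.
case: d => // -[|a] _ //=; have := bernoulli_nat a.+1 a.+2.
set u := _ ^ _; set v := _ ^ _; nia.
Qed.

(** [2K] rounds halve the missed points, and [n * q + 1] halvings leave fewer than one of at most
    [2 ^ (n * q)] points. *)
Definition hit_steps (K n q : nat) := 2 * K * (n * q).+1.

Definition loss (K n q : nat) := hit_steps K n q * q.+1.

Section Project.
Variables (I T : finType) (q : nat).
Hypothesis Tq : #|T| = 2 ^ q.
Local Notation X := {ffun I -> T}.
Local Notation Y := {ffun I -> {ffun T -> bool}}.
Local Notation loss K := (loss K #|I| q).

(** After [hit_steps] rounds [U] meets every line of [A], so [h] lifts each point of the cylinder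
    into [A] through an address in [U], on which all tables of [B'] answer [b]. *)
Lemma project K (A : {set X}) (B : {set Y}) i b l : 0 < K -> thick K A ->
    #|{: Y}| <= #|B| * 2 ^ l -> (l + loss K).+1 * (2 * K) <= #|T| ->
  exists h (B' : {set Y}), [/\ B' \subset B, #|{: Y}| <= #|B'| * 2 ^ (l + loss K),
    (forall x, x \in cyl i A -> upd x i (h x) \in A) &
    (forall x y, x \in cyl i A -> y \in B' -> y i (h x) = b)].
Proof.
move=> K0 tA Bl lT; pose t := hit_steps K #|I| q.
have [U [UA UB]] := hitting (t := t) i b K0 Tq (fintype.subxx A) tA Bl lT.
set B' := [set y in B | _] in UB.
have AU x : x \in A -> ~~ [disjoint U & line A i x].
  move=> xA; apply/negP => xU.
  have : 0 < #|[set x in A | [disjoint U & line A i x]]|.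
    by apply/card_gt0P; exists x; rewrite inE xA.
  have := expn_pred_half (d := 2 * K); rewrite muln_gt0 K0 => /(_ isT) half.
  have halft : 2 ^ (#|I| * q).+1 * (2 * K).-1 ^ t <= (2 * K) ^ t.
    by rewrite /t /hit_steps [X in _ * X]expnM [X in _ <= X]expnM -expnMn leq_exp2r.
  have cA : #|A| <= 2 ^ (#|I| * q).
    by apply: leq_trans (max_card _) _; rewrite card_ffun Tq -expnM mulnC.
  have p0 : 0 < (2 * K) ^ t by rewrite expn_gt0 muln_gt0 K0.
  move: UA halft p0; rewrite expnS; nia.
pose h x := if [pick a in U :&: line A i x] is Some a then a else x i.
have hP x : x \in cyl i A -> h x \in U /\ upd x i (h x) \in A.
  move=> /cylP[a /AU]; rewrite line_upd /h; case: pickP => [c|none].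
    by rewrite !inE => /andP[].
  case/negP; apply/pred0P => c /=; have := none c; by rewrite inE.
exists h, B'; split.
- by apply/fintype.subsetP => y; rewrite inE => /andP[].
- apply: leq_trans Bl _; rewrite [l + _]addnC expnD mulnA leq_mul2r.
  by apply/orP; right.
- by move=> x /hP[].
- by move=> x y /hP[hU _]; rewrite inE => /andP[_ /forallP/(_ (h x))/implyP/(_ hU)/eqP].
Qed.

End Project.

(** * Simulation of protocols by decision trees *)

Lemma majority (V : finType) (C : {set V}) (g : V -> bool) :
  exists e (C' : {set V}), [/\ C' \subset C, #|C| <= 2 * #|C'| & forall x, x \in C' -> g x = e].
Proof.
pose C1 := [set x in C | g x].
have s1 : C1 \subset C by apply/fintype.subsetP => x; rewrite inE => /andP[].
have := cardsID C1 C; rewrite (setIidPr s1) => E.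
have [le|/ltnW le] := leqP #|C :\: C1| #|C1|.
  by exists true, C1; split=> [//||x]; [lia|rewrite inE => /andP[]].
exists false, (C :\: C1); split; [exact: subsetDl|by lia|move=> x].
by rewrite !inE => /andP[+ xC]; rewrite xC => /negbTE.
Qed.

Section Simulation.
Variables (n q : nat) (T : finType).
Hypothesis n_gt0 : 0 < n.
Hypothesis Tq : #|T| = 2 ^ q.
Local Notation X := {ffun 'I_n -> T}.
Local Notation Y := {ffun 'I_n -> {ffun T -> bool}}.
Implicit Types (A : {set X}) (B : {set Y}).

Definition ind (x : X) (y : Y) : input n := [ffun i => y i (x i)].

(* [K1] is the thickness restored before each message; halving [A] and removing
   sparse lines leaves [K2], which queries preserve. *)
Local Notation K1 := (2 * #|'I_n| * 8).
Local Notation K2 := (2 * #|'I_n| * (2 * K1)).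
Local Notation tau := (loss K2 #|'I_n| q).

Let K1_gt0 : 0 < K1. Proof. by rewrite card_ord !muln_gt0 n_gt0. Qed.
Let K2_gt0 : 0 < K2. Proof. by rewrite card_ord !muln_gt0 n_gt0. Qed.
Let K12 : K1 <= K2. Proof. by rewrite card_ord; nia. Qed.
Let T_gt0 : 0 < #|T|. Proof. by rewrite Tq expn_gt0. Qed.
Let X_gt0 : 0 < #|{: X}|.
Proof. by case/card_gt0P: T_gt0 => a _; apply/card_gt0P; exists [ffun=> a]. Qed.
Let Y_gt0 : 0 < #|{: Y}|.
Proof. by apply/card_gt0P; exists [ffun=> [ffun=> false]]. Qed.

Lemma ind_upd x y i a : ind (upd x i a) y = upd (ind x y) i (y i a).
Proof. by apply/ffunP => j; rewrite !ffunE; case: eqP => [->|]. Qed.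

(** [project] prescribes the gadget values one index at a time; passing to the cylinder leaves [x i]
    free until [h] sets it. *)
Lemma ind_onto A B l (s : seq 'I_n) (z : input n) : 0 < #|A| -> thick K2 A ->
    #|{: Y}| <= #|B| * 2 ^ l -> (l + size s * tau).+1 * (2 * K2) <= #|T| ->
  exists x y, [/\ x \in A, y \in B & {in s, ind x y =1 z}].
Proof.
elim: s A B l => [|i s IH] A B l A0 tA Bl lT.
  have /card_gt0P[y yB] : 0 < #|B| by move: (leq_trans Y_gt0 Bl); rewrite muln_gt0 => /andP[].
  by have /card_gt0P[x xA] := A0; exists x, y.
have {}lT : (l + tau + size s * tau).+1 * (2 * K2) <= #|T| by rewrite -addnA -mulSn.
have lT' : (l + tau).+1 * (2 * K2) <= #|T|.
  by apply: leq_trans lT; rewrite leq_mul2r ltnS leq_addr orbT.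
have [h [B' [/fintype.subsetP sB B'l hA hB]]] := project Tq i (z i) K2_gt0 tA Bl lT'.
have cA0 : 0 < #|cyl i A| by apply: leq_trans A0 _; apply/subset_leq_card/sub_cyl.
have [x [y [xA yB xy]]] := IH _ _ _ cA0 (thick_cyl K2_gt0 tA) B'l lT.
exists (upd x i (h x)), y; split; [exact: hA|exact: sB|move=> j].
rewrite ind_upd inE; case: (eqVneq j i) => [->|ji] /=; first by rewrite upd_at hB.
by move/xy => <-; rewrite upd_off.
Qed.

Section Protocols.
Variables P Q : Type.
Implicit Type p : protocol P Q.

(* [log_8 (|X| / |A|) <= s] is the potential: a message raises it by at most one
   and a query lowers it by one. The factor [a] is 2 while querying, so that one
   further removal of sparse lines is prepaid. *)
Definition simulable p c K a := forall s l (f : boolfun n) A B (u : X -> P) (v : Y -> Q),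
  thick K A -> a * #|{: X}| <= 8 ^ s * #|A| -> #|{: Y}| <= #|B| * 2 ^ l ->
  (l + c + (s + c + n) * tau).+1 * (2 * K2) <= #|T| ->
  (forall x y, x \in A -> y \in B ->
    p_bits p (u x) (v y) <= c /\ p_out p (u x) (v y) = f (ind x y)) ->
  exists2 t, dt_computes t f & dt_depth t <= s + c.

(** If some cylinder is at least eight times larger than [A], that index is queried and the cylinder
    replaces [A]; otherwise [thick_subset] with [K = 8] restores thickness [K1] and uses up the
    factor 2. *)
Lemma simulable_query p c : simulable p c K1 1 -> simulable p c K2 2.
Proof.
move=> simp; elim=> [|s IH] l f A B u v tA Xs Bl lT pf.
  apply: (simp 0 l f A B u v) => //; last by apply: leq_trans Xs; rewrite leq_mul2r orbT.
  move=> x _ i; suff -> : A = setT by apply: (thickT K1_gt0); rewrite finset.in_setT.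
  by apply/eqP; rewrite eqEcard subsetT cardsT; move: Xs; rewrite expn0 mul1n; apply: leq_trans; rewrite leq_pmull.
have [/existsP[i ci]|none] := boolP [exists i, 8 * #|A| <= #|cyl i A|].
  have lT' : (l + tau).+1 * (2 * K2) <= #|T|.
    apply: leq_trans lT; rewrite leq_mul2r ltnS -[l + c + _]addnA leq_add2l.
    by rewrite (leq_trans _ (leq_addl _ _)) ?orbT // !addSn leq_pmull.
  have tree b : exists2 t, dt_computes t (fun z => f (upd z i b)) & dt_depth t <= s + c.
    have [h [B' [/fintype.subsetP sB B'l hA hB]]] := project Tq i b K2_gt0 tA Bl lT'.
    (* Points of the cylinder stand for their lifts by [h], so [u] is precomposed with the lift and
       the protocol is unchanged. *)
    apply: (IH (l + tau) _ (cyl i A) B' (fun x => u (upd x i (h x))) v) => //.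
    - exact: thick_cyl.
    - apply: leq_trans Xs _; rewrite expnSr -mulnA leq_mul2l; by rewrite ci orbT.
    - move: lT; rewrite !addSn mulSn; congr (is_true (_.+1 * _ <= _)); lia.
    move=> x y xA yB; have [] := pf _ y (hA x xA) (sB y yB).
    by rewrite ind_upd (hB x y xA yB).
  have [[t0 t0f d0] [t1 t1f d1]] := (tree false, tree true).
  exists (DQuery i t0 t1); last by rewrite /= addSn ltnS geq_max d0 d1.
  by move=> z /=; case zi: (z i); rewrite ?t0f ?t1f -zi upd_id.
have cA i : #|cyl i A| <= 8 * #|A|.
  by apply: ltnW; rewrite ltnNge; apply/negP => ci; case/negP: none; apply/existsP; exists i.
have [|A' [/fintype.subsetP sA AA' tA']] := thick_subset (K := 8) isT _ cA; first by rewrite card_ord.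
apply: (simp s.+1 l f A' B u v) => //; last by move=> x y /sA xA; apply: pf.
move: #|A| #|A'| AA' Xs => a a'; set w := 8 ^ _; nia.
Qed.

Lemma simulable_all p c : simulable p c K1 1.
Proof.
elim: p c => [b|a p0 IH0 p1 IH1|b p0 IH0 p1 IH1] c s l f A B u v tA Xs Bl lT pf.
all: have [x0 x0A] : exists x, x \in A
  by apply/card_gt0P; move: Xs; rewrite mul1n => /(leq_trans X_gt0); rewrite muln_gt0 => /andP[].
all: have [y0 y0B] : exists y, y \in B
  by apply/card_gt0P; move: (leq_trans Y_gt0 Bl); rewrite muln_gt0 => /andP[].
(* Every [z] is [ind x y] for some point of the rectangle, so the constant output forces [f] to be
   constant. The reserve [n * tau] in the budget pays for [ind_onto] over all indices. *)
- exists (DLeaf b) => // z /=.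
  have A0 : 0 < #|A| by apply/card_gt0P; exists x0.
  have [|x [y [xA yB xy]]] := @ind_onto A B l (enum 'I_n) z A0 (thickW K12 tA) Bl.
    apply: leq_trans lT; rewrite leq_mul2r ltnS -cardE card_ord; apply/orP; right.
    by rewrite -addnA leq_add2l addnC mulnDl -addnA addnCA leq_addr.
  have [_ /= ->] := pf x y xA yB; congr f; apply/ffunP => i; apply: xy.
  by rewrite mem_enum.
- case: c lT pf => [|c] lT pf; first by have [] := pf x0 y0 x0A y0B.
  have [e [A' [sA' AA' A'e]]] := majority A (a \o u).
  have cA i : #|cyl i A'| <= 2 * K1 * #|A'|.
    apply: (@leq_trans #|cyl i A|); first exact/subset_leq_card/cylS.
    apply: leq_trans (thick_card_cyl i T_gt0 tA) _.
    by rewrite -[X in _ <= X]mulnA [X in _ <= X]mulnCA leq_mul2l AA' orbT.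
  have [||A2 [/fintype.subsetP sA2 A2A' tA2]] := thick_subset _ _ cA.
  - by rewrite muln_gt0 K1_gt0.
  - by rewrite card_ord.
  have sim2 : simulable (if e then p1 else p0) c K2 2.
    by apply: simulable_query; case: (e); [exact: IH1|exact: IH0].
  (* Raising [s] by one gains a factor 8: 2 pays for the majority, 2 for removing sparse lines, and
     2 is the prepaid factor of [simulable_query]. *)
  rewrite addnS -addSn; apply: (sim2 s.+1 l f A2 B u v) => //.
  + move: #|A| #|A'| #|A2| Xs AA' A2A' => x y z; rewrite expnS; set w := 8 ^ _; nia.
  + apply: leq_trans lT; rewrite leq_mul2r; apply/orP; right; lia.
  move=> x y /sA2 xA' yB; have [/=] := pf x y (fintype.subsetP sA' _ xA') yB.
  by rewrite (A'e _ xA' : a (u x) = e); case: (e).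
case: c lT pf => [|c] lT pf; first by have [] := pf x0 y0 x0A y0B.
have [e [B' [/fintype.subsetP sB BB' B'e]]] := majority B (b \o v).
have simB : simulable (if e then p1 else p0) c K1 1 by case: (e); [exact: IH1|exact: IH0].
have [|||t tf td] := simB s l.+1 f A B' u v tA Xs.
- apply: leq_trans Bl _; rewrite expnS; move: (2 ^ l) #|B| #|B'| BB' => w x y; nia.
- apply: leq_trans lT; rewrite leq_mul2r; apply/orP; right; lia.
- move=> x y xA yB; have [/=] := pf x y xA (sB _ yB).
  by rewrite (B'e _ yB : b (v y) = e); case: (e).
by exists t => //; apply: leq_trans td _; rewrite leq_add2l.
Qed.

End Protocols.

End Simulation.

(** * From the simulation to the communication complexity of the composed function *)

Lemma D_le n (f : boolfun n) t d : dt_computes t f -> dt_depth t <= d -> D f <= d.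
Proof.
move=> tf td; rewrite /D; case: ex_minnP => m _ min; apply: leq_trans (min _ _) td.
by apply/asboolP; exists t.
Qed.

Lemma D_le_arity n (f : boolfun n) : D f <= n.
Proof.
suff H (s : seq 'I_n) : forall g : boolfun n,
    (forall x y : input n, {in s, x =1 y} -> g x = g y) ->
    exists2 t, dt_computes t g & dt_depth t <= size s.
  have [x y xy|t tf td] := H (enum 'I_n) f.
    by congr f; apply/ffunP => i; apply: xy; rewrite mem_enum.
  by apply: D_le tf _; rewrite size_enum_ord in td.
elim: s => [|i s IH] g gP.
  by exists (DLeaf (g [ffun=> false])) => // x /=; apply: gP.
have tree b : exists2 t, dt_computes t (fun x => g (upd x i b)) & dt_depth t <= size s.
  apply: IH => x y xy; apply: gP => j; rewrite inE; case: (eqVneq j i) => [-> _|ji] /=.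
    by rewrite !upd_at.
  by rewrite !upd_off // => /xy.
have [[t0 t0g d0] [t1 t1g d1]] := (tree false, tree true).
exists (DQuery i t0 t1); last by rewrite /= ltnS geq_max d0 d1.
by move=> x /=; case xi: (x i); rewrite ?t0g ?t1g -xi upd_id.
Qed.

Section Composition.
Variables n q : nat.
Local Notation T := {ffun 'I_q -> bool}.

(* The gadget is the indexing function; its [q] address bits belong to Alice
   and its table of [2 ^ q] bits to Bob. *)
Definition slot : finType := ('I_n * ('I_q + {ffun 'I_q -> bool}))%type.
Local Notation N := #|{: slot}|.

Definition addr (x : input N) (i : 'I_n) : T := [ffun k => x (enum_rank ((i, inl k) : slot))].

Definition tbl (x : input N) (i : 'I_n) : {ffun T -> bool} :=
  [ffun a => x (enum_rank ((i, inr a) : slot))].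

Definition select (x : input N) : input n := [ffun i => tbl x i (addr x i)].

Definition lifted (f : boolfun n) : boolfun N := fun x => f (select x).

Definition alice : {set 'I_N} := [set w | if (enum_val w : slot).2 is inl _ then true else false].

Definition pack (a : {ffun 'I_n -> T}) (y : {ffun 'I_n -> {ffun T -> bool}}) : input N :=
  [ffun w => match (enum_val w : slot) with (i, inl k) => a i k | (i, inr t) => y i t end].

Lemma select_pack a y : select (pack a y) = ind a y.
Proof.
apply/ffunP => i; rewrite !ffunE enum_rankK; congr (y i _).
by apply/ffunP => k; rewrite !ffunE enum_rankK.
Qed.

Lemma restr_alice a y y' : restr alice (pack a y) = restr alice (pack a y').
Proof.
apply/ffunP => -[w wA]; rewrite !ffunE /=.
by move: wA; rewrite inE; case: (enum_val w) => i [].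
Qed.

Lemma restr_bob a a' y : restr (~: alice) (pack a y) = restr (~: alice) (pack a' y).
Proof.
apply/ffunP => -[w wA]; rewrite !ffunE /=.
by move: wA; rewrite !inE; case: (enum_val w) => i [].
Qed.

Lemma card_slot : N = n * (q + 2 ^ q).
Proof. by rewrite card_prod card_sum card_ffun card_bool !card_ord. Qed.

Lemma CC_lifted (f : boolfun n) : 0 < n ->
    (n + (n + n) * loss (64 * n ^ 2) n q).+1 * (128 * n ^ 2) <= 2 ^ q ->
  D f <= CC (lifted f) alice.
Proof.
move=> n0; have -> : 64 * n ^ 2 = 2 * #|'I_n| * (2 * (2 * #|'I_n| * 8)) by rewrite card_ord; lia.
have -> : 128 * n ^ 2 = 2 * (2 * #|'I_n| * (2 * (2 * #|'I_n| * 8))) by rewrite card_ord; lia.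
(* If the communication exceeds [n], querying all bits is enough; otherwise [c <= n], and the budget
   depends on [n] and [q] only. *)
move=> big; have [|lt] := leqP (CC (lifted f) alice) n; last first.
  exact: leq_trans (D_le_arity f) (ltnW lt).
rewrite /CC; case: ex_minnP => c /asboolP[p [pf pc]] _ cn.
pose y0 : {ffun 'I_n -> {ffun T -> bool}} := [ffun=> [ffun=> false]].
pose a0 : {ffun 'I_n -> T} := [ffun=> [ffun=> false]].
have Tq : #|{: T}| = 2 ^ q by rewrite card_ffun card_bool card_ord.
have [|||||t tf td] := simulable_all n0 Tq (p := p) (c := c) (s := 0) (l := 0) (f := f) (A := setT)
  (B := setT) (u := fun a => restr alice (pack a y0)) (v := fun y => restr (~: alice) (pack a0 y)).
- by apply: thickT; rewrite card_ord !muln_gt0 n0.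
- by rewrite cardsT !mul1n.
- by rewrite cardsT muln1.
- rewrite Tq; apply: leq_trans big; rewrite !add0n [X in loss _ X]card_ord leq_mul2r ltnS.
  by rewrite leq_add ?orbT // leq_mul2r leq_add2r cn orbT.
- move=> a y _ _; rewrite (restr_alice a y0 y) (restr_bob a0 a y); split.
    by rewrite -pc; apply: (leq_bigmax (pack a y)).
  by rewrite pf /lifted select_pack.
exact: D_le tf td.
Qed.

End Composition.

(** Every factor is bounded by a power of two; the exponents add up to [28 + 8 * r], at most
    [40 * r] because [r >= 1]. *)
Lemma gadget_size n r q : 0 < n -> n < 2 ^ r -> q = 40 * r ->
  (n + (n + n) * loss (64 * n ^ 2) n q).+1 * (128 * n ^ 2) <= 2 ^ q.
Proof.
move=> n0 nr qE; have r0 : 0 < r by case: r nr {qE} => //; rewrite expn0; lia.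
have nr2 : n ^ 2 <= 2 ^ (r * 2) by rewrite expnM leq_exp2r // ltnW.
have k1 : 64 * n ^ 2 <= 2 ^ (6 + r * 2) by rewrite expnD leq_mul.
have k2 : 128 * n ^ 2 <= 2 ^ (7 + r * 2) by rewrite expnD leq_mul.
have q1 : q.+1 <= 2 ^ (6 + r).
  by have := ltn_expl r (leqnn 2); rewrite qE expnD; set w := 2 ^ r; move: w => w; lia.
have nq : (n * q).+1 <= 2 ^ (r + (6 + r)).
  by rewrite expnD; apply: leq_trans (leq_mul (ltnW nr) q1); nia.
have t1 : loss (64 * n ^ 2) n q <= 2 ^ (1 + (6 + r * 2) + (r + (6 + r)) + (6 + r)).
  by rewrite /loss /hit_steps expnD leq_mul // expnD leq_mul // expnD leq_mul.
have t0 : 0 < loss (64 * n ^ 2) n q by rewrite /loss /hit_steps !muln_gt0 n0.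
have le : (n + (n + n) * loss (64 * n ^ 2) n q).+1 <= 2 ^ (2 + r + (1 + (6 + r * 2) + (r + (6 + r)) + (6 + r))).
  rewrite (expnD 2 (2 + r)) (expnD 2 2); apply: leq_trans (leq_mul (leq_mul (leqnn _) (ltnW nr)) t1).
  by move: (loss _ _ _) t0 => u u0; nia.
apply: leq_trans (leq_mul le k2) _; rewrite -expnD leq_exp2l //; lia.
Qed.

(** * Degree and block sensitivity of the composition *)

Section Degree.
Local Open Scope ring_scope.
Variable R : realType.

Definition deg_le n d (p : {mpoly R[n]}) := forall m, m \in msupp p -> (mdeg m <= d)%N.

Lemma deg_leW n d d' (p : {mpoly R[n]}) : (d <= d')%N -> deg_le d p -> deg_le d' p.
Proof. by move=> dd pd m /pd md; apply: leq_trans md dd. Qed.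

Lemma deg_le_sum n d (J : Type) (s : seq J) (Q : pred J) (F : J -> {mpoly R[n]}) :
  (forall j, Q j -> deg_le d (F j)) -> deg_le d (\sum_(j <- s | Q j) F j).
Proof.
move=> Fd; elim/big_ind: _ => // [m|p p' pd pd' m]; first by rewrite msupp0.
by move/msuppD_le; rewrite mem_cat => /orP[/pd|/pd'].
Qed.

Lemma deg_leM n d d' (p p' : {mpoly R[n]}) :
  deg_le d p -> deg_le d' p' -> deg_le (d + d') (p * p').
Proof.
move=> pd pd' m /msuppM_le /allpairsP[[m1 m2] /= [/pd m1d /pd' m2d ->]].
by rewrite mdegD leq_add.
Qed.

Lemma deg_le1 n d : deg_le d (1 : {mpoly R[n]}).
Proof. by move=> m; rewrite msupp1 inE => /eqP ->; rewrite mdeg0. Qed.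

Lemma deg_le_prod n (J : Type) (s : seq J) (Q : pred J) (d : J -> nat) (F : J -> {mpoly R[n]}) :
  (forall j, Q j -> deg_le (d j) (F j)) ->
  deg_le (\sum_(j <- s | Q j) d j)%N (\prod_(j <- s | Q j) F j).
Proof. by move=> Fd; elim/big_ind2: _ => //; [exact: deg_le1|move=> *; apply: deg_leM]. Qed.

Lemma deg_leXn n d (p : {mpoly R[n]}) k : deg_le d p -> deg_le (k * d) (p ^+ k).
Proof.
move=> pd; elim: k => [|k IH]; first by rewrite expr0; apply: deg_le1.
by rewrite exprS mulSn; apply: deg_leM.
Qed.

Lemma deg_leZ n d c (p : {mpoly R[n]}) : deg_le d p -> deg_le d (c *: p).
Proof. by move=> pd m /msuppZ_le /pd. Qed.

Lemma deg_leXU n (i : 'I_n) : deg_le 1 ('X_i : {mpoly R[n]}).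
Proof. by move=> m; rewrite msuppX inE => /eqP ->; rewrite mdeg1. Qed.

Lemma deg_leB n d (p p' : {mpoly R[n]}) : deg_le d p -> deg_le d p' -> deg_le d (p - p').
Proof. by move=> pd pd' m /msuppB_le; rewrite mem_cat => /orP[/pd|/pd']. Qed.

Lemma mlpolyP n (f : boolfun n) : multilinear (mlpoly R f) /\ agrees (mlpoly R f) f.
Proof. exact: (svalP (cid (mlpoly_exists R f))). Qed.

Lemma mlpoly_deg n (f : boolfun n) : deg_le (deg R f) (mlpoly R f).
Proof. by move=> m /msize_mdeg_lt lt; rewrite /deg -ltnS (leq_trans lt) // leqSpred. Qed.

(* Truncating all exponents to 1 preserves the values on the cube. *)
Lemma deg_agrees n d (f : boolfun n) (p : {mpoly R[n]}) :
  deg_le d p -> agrees p f -> (deg R f <= d)%N.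
Proof.
move=> pd pf; pose tr (m : 'X_{1..n}) := [multinom minn (m i) 1 | i < n].
pose r := \sum_(m <- msupp p) p@_m *: 'X_[tr m] : {mpoly R[n]}.
have rE m : m \in msupp r -> exists2 m', m' \in msupp p & m = tr m'.
  move=> /msupp_sum_le /flattenP[s /mapP[m']]; rewrite mem_filter /= => m'p -> /msuppZ_le.
  by rewrite msuppX inE => /eqP; exists m'.
have rml : multilinear r.
  by move=> m /rE[m' _ ->] i; rewrite mnmE geq_minr.
have rd : deg_le d r.
  move=> m /rE[m' /pd m'd ->]; apply: leq_trans m'd; rewrite !mdegE.
  by apply: leq_sum => i _; rewrite mnmE geq_minl.
have rf : agrees r f.
  move=> x; rewrite -pf [RHS]mevalE raddf_sum /=; apply: eq_bigr => m _.
  rewrite mevalZ mevalX; congr (_ * _); apply: eq_bigr => i _; rewrite mnmE.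
  by case: (x i); rewrite ?expr1n // !expr0n; case: (m i) => // k; rewrite minnC.
have [ml fl] := mlpolyP f.
rewrite /deg (mlpoly_unique ml fl rml rf) msizeE -ltnS.
(* The maximum with 1 covers [r = 0], where [msize] is 0 and its predecessor truncates. *)
apply: (@leq_trans (maxn 1 (\max_(m <- msupp r) (mdeg m).+1))%N).
  by case: (\max_(_ <- _) _)%N => // k; rewrite leq_max leqnn orbT.
rewrite geq_max /=; apply/bigmax_leqP_seq => m mr _; exact: rd.
Qed.

Section Lifted.
Variables n q : nat.
Local Notation N := #|{: slot n q}|.

Definition slot_var (w : slot n q) : {mpoly R[N]} := 'X_(enum_rank w).

Definition gadget_poly (i : 'I_n) : {mpoly R[N]} :=
  \sum_(a : {ffun 'I_q -> bool}) slot_var (i, inr a) *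
    \prod_(k < q) (if a k then slot_var (i, inl k) else 1 - slot_var (i, inl k)).

Lemma gadget_poly_eval (x : input N) i :
  (gadget_poly i).@[fun w => (x w)%:R] = (select x i)%:R.
Proof.
have ev a : (slot_var (i, inr a) *
    \prod_(k < q) (if a k then slot_var (i, inl k) else 1 - slot_var (i, inl k))).@[fun w => (x w)%:R]
    = (tbl x i a && (a == addr x i))%:R.
  rewrite mevalM mevalXU /= rmorph_prod /= [tbl x i a]ffunE -mulnb natrM; congr (_ * _).
  have [->|/eqP ne] := eqVneq a (addr x i).
    rewrite big1 // => k _; rewrite ffunE; case: ifP => xk; first by rewrite mevalXU xk.
    by rewrite mevalB meval1 mevalXU xk subr0.
  have [k /eqP ak] : exists k, a k != addr x i k.
    by apply/existsP; rewrite -negb_forall; apply/negP => /forallP h; apply: ne; apply/ffunP => k; apply/eqP.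
  rewrite (bigD1 k) //=; move: ak; rewrite ffunE.
  case: (a k) => xk; [rewrite mevalXU|rewrite mevalB meval1 mevalXU].
    by case: (x _) xk => //; rewrite mul0r.
  by case: (x _) xk => //; rewrite subrr mul0r.
rewrite raddf_sum /=; under eq_bigr do rewrite ev.
rewrite (bigD1 (addr x i)) //= eqxx andbT big1 ?addr0 ?ffunE //.
by move=> a /negPf ->; rewrite andbF.
Qed.

Lemma gadget_poly_deg i : deg_le q.+1 (gadget_poly i).
Proof.
apply: deg_le_sum => a _; rewrite -add1n; apply: deg_leM; first exact: deg_leXU.
apply: (@deg_leW _ (\sum_(k < q) 1)); first by rewrite sum1_card card_ord.
apply: deg_le_prod => k _; case: ifP => _; first exact: deg_leXU.
by apply: deg_leB; [exact: deg_le1|exact: deg_leXU].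
Qed.

(** Substituting [gadget_poly] for the variables of [mlpoly R f] multiplies the degree by at most
    [q.+1], and [deg_agrees] passes the bound on to [deg]. *)
Lemma deg_lifted (f : boolfun n) : (deg R (lifted (q := q) f) <= deg R f * q.+1)%N.
Proof.
pose lq := [tuple gadget_poly i | i < n].
apply: (@deg_agrees _ _ _ (mlpoly R f \mPo lq)).
  rewrite comp_mpolyE [X in deg_le _ X]big_seq; apply: deg_le_sum => m mf; apply: deg_leZ.
  apply: (@deg_leW _ (mdeg m * q.+1)); first by rewrite leq_mul2r mlpoly_deg ?orbT.
  rewrite mdegE big_distrl; apply: deg_le_prod => i _; rewrite tnth_mktuple.
  exact/deg_leXn/gadget_poly_deg.
move=> x; rewrite comp_mpoly_meval /lifted -(mlpolyP f).2.
by apply: meval_eq => i; rewrite tnth_mktuple gadget_poly_eval.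
Qed.

End Lifted.

End Degree.

Section FractionalBlocks.
Local Open Scope ring_scope.
Variables (R : realType) (n q : nat) (f : boolfun n).
Local Notation N := #|{: slot n q}|.
Implicit Types (x : input N) (B : {set 'I_N}) (P : {set {set 'I_N}}).

Lemma fbs_at_le_fbs (z : input n) : fbs_at R f z <= fbs R f.
Proof. by rewrite /fbs; apply: le_bigmax. Qed.

Lemma le_fbs (z : input n) w : fbs_feasible f z w ->
  \sum_(C : {set 'I_n} | sensitive f z C) w C <= fbs R f.
Proof.
move=> wf; apply: le_trans (fbs_at_le_fbs z).
by apply: (ub_le_sup (fbs_has_sup R f z).2); exists w.
Qed.

(** Flipping [B] acts on the gadget values as the flip of this set, so sensitive blocks of
    [lifted f] induce sensitive blocks of [f]. *)
Definition changed x B : {set 'I_n} := [set i | select (flip x B) i != select x i].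

Lemma select_flip x B : select (flip x B) = flip (select x) (changed x B).
Proof. by apply/ffunP => i; rewrite [RHS]ffunE inE; case: (select _ i); case: (select _ i). Qed.

Lemma sensitive_changed x B : sensitive (lifted f) x B -> sensitive f (select x) (changed x B).
Proof. by rewrite /sensitive /lifted select_flip. Qed.

(* The [q] address bits and the addressed table bit certify the value of a gadget. *)
Definition cert x (i : 'I_n) (o : option 'I_q) : 'I_N :=
  if o is Some k then enum_rank ((i, inl k) : slot n q)
  else enum_rank ((i, inr (addr x i)) : slot n q).

Lemma changed_cert x B i : i \in changed x B -> [exists o, cert x i o \in B].
Proof.
rewrite inE; apply: contraR; rewrite negb_exists => /forallP nB.
have aE : addr (flip x B) i = addr x i.
  by apply/ffunP => k; rewrite !ffunE (negPf (nB (Some k))) addbF.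
by rewrite !ffunE aE (negPf (nB None)) addbF.
Qed.

(** Each block counted meets the [q.+1] certificate cells of gadget [i], and disjoint blocks meet
    them in different cells. *)
Lemma card_changed x P i : finset.trivIset P ->
  (#|[set B in P | i \in changed x B]| <= q.+1)%N.
Proof.
move=> tP; set S := [set B in P | _].
have cE B : B \in S -> exists o, cert x i o \in B.
  by rewrite inE => /andP[_ /changed_cert/existsP].
pose c B := odflt None [pick o | cert x i o \in B].
have cP B : B \in S -> cert x i (c B) \in B.
  by move=> /cE[o oB]; rewrite /c; case: pickP => [//|/(_ o)]; rewrite oB.
rewrite -(card_in_imset (f := c)).
  by apply: leq_trans (max_card _) _; rewrite card_option card_ord.
move=> B B' BS B'S cBB'; apply/eqP; apply: contraT => ne.
have [BP B'P] : B \in P /\ B' \in P by move: BS B'S; rewrite !inE => /andP[-> _] /andP[-> _].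
have /pred0P/(_ (cert x i (c B))) := trivIsetP tP _ _ BP B'P ne.
by rewrite /= cP // cBB' cP.
Qed.

Lemma sum_card_fibre x P (Q : pred {set 'I_n}) :
  (\sum_(C | Q C) #|[set B in P | changed x B == C]| = #|[set B in P | Q (changed x B)]|)%N.
Proof.
rewrite -[RHS]sum1_card (partition_big (changed x) Q) /=; last by move=> B; rewrite inE => /andP[].
apply: eq_bigr => C QC; rewrite -sum1_card; apply: eq_bigl => B; rewrite !inE -andbA.
by case: eqP => [->|_]; rewrite ?QC ?andbF.
Qed.

Lemma bs_lifted : (bs (lifted (q := q) f))%:R <= q.+1%:R * fbs R f.
Proof.
suff H x P : finset.trivIset P -> [forall B in P, sensitive (lifted f) x B] ->
    #|P|%:R <= q.+1%:R * fbs R f.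
  rewrite /bs; elim/big_ind: _ => [|m m' le le'|x _].
  - by rewrite mulr_ge0 // (le_trans (fbs_at_ge0 R f [ffun=> false])) // fbs_at_le_fbs.
  - by rewrite /maxn; case: ifP.
  elim/big_ind: _ => [|m m' le le'|P /andP[]].
  - by rewrite mulr_ge0 // (le_trans (fbs_at_ge0 R f [ffun=> false])) // fbs_at_le_fbs.
  - by rewrite /maxn; case: ifP.
  exact: H.
(* Every block of [P] gives weight [1 / q.+1] to the block it induces; [card_changed] makes this
   feasible, and the total is [#|P| / q.+1]. *)
move=> tP /forallP sP; pose w C : R := #|[set B in P | changed x B == C]|%:R / q.+1%:R.
have q0 : 0 < q.+1%:R :> R by rewrite ltr0n.
have sumw Q : \sum_(C | Q C) w C = #|[set B in P | Q (changed x B)]|%:R / q.+1%:R.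
  by rewrite -mulr_suml -natr_sum sum_card_fibre.
have sens B : B \in P -> sensitive f (select x) (changed x B).
  by move=> BP; apply/sensitive_changed/(implyP (sP B)).
have point i (Q : pred {set 'I_n}) : (forall C, Q C -> i \in C) -> \sum_(C | Q C) w C <= 1.
  move=> Qi; rewrite sumw ler_pdivrMr // mul1r ler_nat.
  apply: leq_trans (card_changed x i tP); apply/subset_leq_card/fintype.subsetP => B.
  by rewrite [_ \in [set _ in _ | Q _]]inE [_ \in [set _ in _ | _ \in _]]inE => /andP[-> /Qi].
have wf : fbs_feasible f (select x) w.
  split=> [C sC|i]; last by apply: (point i) => C /andP[].
  (* For [w C <= 1]: a sensitive [C] is nonempty, and [point] applies at any of its elements. *)
  rewrite divr_ge0 //=; have [C0|[i iC]] := set_0Vmem C.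
    move: sC; rewrite C0 /sensitive; have -> : flip (select x) finset.set0 = select x.
      by apply/ffunP => j; rewrite ffunE inE addbF.
    by rewrite eqxx.
  have := point i (pred1 C); rewrite big_pred1_eq; apply; by move=> _ /eqP ->.
have := le_fbs wf; rewrite sumw ler_pdivrMr // mulrC.
suff -> : [set B in P | sensitive f (select x) (changed x B)] = P by [].
by apply/setP => B; rewrite inE andb_idr // => /sens.
Qed.

End FractionalBlocks.

(** * Logarithmic gadget size and polylogarithmic bounds *)

Section Polylog.
Local Open Scope ring_scope.
Variable R : realType.

Lemma log2_exp k : log2 (2 ^ k) = k%:R :> R.
Proof. by rewrite /log2 natrX lnXn ?ltr0n // -[ln _ *+ _]mulr_natl mulfK // gt_eqF // ln_gt0 // ltr1n. Qed.

Lemma le_log2 m n : (0 < m)%N -> (m <= n)%N -> log2 m <= log2 n :> R.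
Proof.
move=> m0 mn; rewrite /log2 ler_pM2r ?invr_gt0 ?ln_gt0 ?ltr1n //.
by rewrite ler_ln ?posrE ?ltr0n ?ler_nat // (leq_trans m0).
Qed.

Lemma trunc_log_le n : (0 < n)%N -> (trunc_log 2 n)%:R <= log2 n :> R.
Proof. by move=> n0; rewrite -log2_exp le_log2 ?expn_gt0 ?trunc_logP. Qed.

(** [(trunc_log 2 n).+1] is an exponent [r] with [n < 2 ^ r], and 40 is the multiple that
    [gadget_size] asks for. *)
Definition addr_len n := (40 * (trunc_log 2 n).+1)%N.

Lemma addr_len_le n : (2 <= n)%N -> (addr_len n).+1%:R <= 82 * log2 n :> R.
Proof.
move=> n2; have t1 : (0 < trunc_log 2 n)%N by rewrite trunc_log_gt0.
apply: (@le_trans _ _ (82 * (trunc_log 2 n)%:R)); first by rewrite -natrM ler_nat /addr_len; lia.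
by rewrite ler_pM2l // trunc_log_le // ltnW.
Qed.

(** With [t = trunc_log 2 n], there are at most [2 ^ (41 t + 42)] slots, and [41 t + 42 <= 84 t]
    since [t >= 1]. *)
Lemma log2_slot_le n : (2 <= n)%N -> log2 #|{: slot n (addr_len n)}| <= 84 * log2 n :> R.
Proof.
move=> n2; have t1 : (0 < trunc_log 2 n)%N by rewrite trunc_log_gt0.
apply: (@le_trans _ _ (84 * (trunc_log 2 n)%:R)); last by rewrite ler_pM2l // trunc_log_le // ltnW.
rewrite -natrM -log2_exp le_log2 // card_slot.
  by rewrite muln_gt0 addn_gt0 expn_gt0 orbT andbT (leq_trans _ n2).
have nr : (n <= 2 ^ (trunc_log 2 n).+1)%N by apply/ltnW/trunc_log_ltn.
have qq : (addr_len n + 2 ^ addr_len n <= 2 ^ (addr_len n).+1)%N.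
  by rewrite expnS mul2n -addnn leq_add2r ltnW // ltn_expl.
apply: leq_trans (leq_mul nr qq) _; rewrite -expnD leq_exp2l // /addr_len; lia.
Qed.

(** The factor [(addr_len n).+1], squared, supplies the two extra logarithms and [82 ^+ 2]; the
    larger number of variables supplies the power of 84. *)
Lemma polylog_bound (c k d : R) n : 0 <= c -> 0 < k -> 0 <= d -> (2 <= n)%N ->
  c * ((addr_len n).+1%:R * d) ^+ 2 * (log2 #|{: slot n (addr_len n)}| `^ k) <=
  c * (82 ^+ 2 * 84 `^ k) * d ^+ 2 * (log2 n `^ (k + 2)) :> R.
Proof.
move=> c0 k0 d0 n2; have L1 : 0 < log2 n :> R.
  by rewrite /log2 divr_gt0 // ln_gt0 // ltr1n.
have LN : 0 <= log2 #|{: slot n (addr_len n)}| :> R.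
  apply: (@le_trans _ _ (log2 1)); first by rewrite /log2 ln1 mul0r.
  apply: le_log2 => //; rewrite card_slot.
  by rewrite muln_gt0 addn_gt0 expn_gt0 orbT andbT (leq_trans _ n2).
have -> : log2 n `^ (k + 2) = log2 n `^ k * log2 n ^+ 2 :> R.
  by rewrite powRD ?(gt_eqF L1) ?implybT // powR_mulrn // ltW.
have -> : c * (82 ^+ 2 * 84 `^ k) * d ^+ 2 * (log2 n `^ k * log2 n ^+ 2) =
    c * (82 * log2 n * d) ^+ 2 * (84 * log2 n) `^ k :> R.
  by rewrite powRM // ?ltW // !exprMn; ring.
apply: ler_pM; [by rewrite mulr_ge0 ?sqr_ge0|exact: powR_ge0| |].
  apply: ler_wpM2l => //; rewrite ler_sqr; first by rewrite ler_wpM2r // addr_len_le.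
    by rewrite nnegrE mulr_ge0.
  by rewrite nnegrE; apply: mulr_ge0 => //; apply: mulr_ge0 => //; exact: ltW.
apply: (ge0_ler_powR (ltW k0) _ _ (log2_slot_le n2)); rewrite nnegrE //.
by apply: mulr_ge0 => //; exact: ltW.
Qed.

End Polylog.

Lemma D_le_CC_lifted n (f : boolfun n) : 2 <= n ->
  D f <= CC (lifted (q := addr_len n) f) (alice n (addr_len n)).
Proof.
move=> n2; have n0 := ltnW n2; apply: CC_lifted => //.
exact: gadget_size n0 (trunc_log_ltn n (isT : 1 < 2)) erefl.
Qed.

Lemma slot_gt1 n q : 2 <= n -> 2 <= #|{: slot n q}|.
Proof.
move=> n2; rewrite card_slot; apply: leq_trans n2 _.
by rewrite leq_pmulr // addn_gt0 expn_gt0 orbT.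
Qed.

Local Open Scope ring_scope.

Theorem theorem4 (R : realType) :
  ((exists c1 k1 : R, [/\ 0 < c1, 0 < k1 &
      forall n : nat, (2 <= n)%N ->
      forall (f : {ffun 'I_n -> bool} -> bool) (S : {set 'I_n}),
        (CC f S)%:R <= c1 * (deg R f)%:R ^+ 2 * (log2 n `^ k1)]) ->
   (exists c2 k2 : R, [/\ 0 < c2, 0 < k2 &
      forall n : nat, (2 <= n)%N ->
      forall f : {ffun 'I_n -> bool} -> bool,
        (D f)%:R <= c2 * (deg R f)%:R ^+ 2 * (log2 n `^ k2)]))
  /\
  ((exists c1 k1 : R, [/\ 0 < c1, 0 < k1 &
      forall n : nat, (2 <= n)%N ->
      forall (f : {ffun 'I_n -> bool} -> bool) (S : {set 'I_n}),
        (CC f S)%:R <= c1 * (bs f)%:R ^+ 2 * (log2 n `^ k1)]) ->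
   (exists c2 k2 : R, [/\ 0 < c2, 0 < k2 &
      forall n : nat, (2 <= n)%N ->
      forall f : {ffun 'I_n -> bool} -> bool,
        (D f)%:R <= c2 * fbs R f ^+ 2 * (log2 n `^ k2)])).
Proof.
split=> -[c [k [c0 k0 Cf]]]; exists (c * (82 ^+ 2 * 84 `^ k)), (k + 2).
  split=> [||n n2 f]; rewrite ?addr_gt0 ?mulr_gt0 ?exprn_gt0 ?powR_gt0 //.
  apply: le_trans (polylog_bound (ltW c0) k0 (ler0n R (deg R f)) n2).
  apply: (@le_trans _ _ (CC (lifted (q := addr_len n) f) (alice n (addr_len n)))%:R).
    by rewrite ler_nat D_le_CC_lifted.
  apply: le_trans (Cf _ (slot_gt1 _ n2) _ _) _.
  rewrite ler_wpM2r ?powR_ge0 // ler_wpM2l ?(ltW c0) // ler_sqr ?nnegrE ?mulr_ge0 //.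
  by rewrite -natrM ler_nat mulnC deg_lifted.
split=> [||n n2 f]; rewrite ?addr_gt0 ?mulr_gt0 ?exprn_gt0 ?powR_gt0 //.
have fbs0 : 0 <= fbs R f.
  by apply: le_trans (fbs_at_le_fbs R f [ffun=> false]); apply: fbs_at_ge0.
apply: le_trans (polylog_bound (ltW c0) k0 fbs0 n2).
apply: (@le_trans _ _ (CC (lifted (q := addr_len n) f) (alice n (addr_len n)))%:R).
  by rewrite ler_nat D_le_CC_lifted.
apply: le_trans (Cf _ (slot_gt1 _ n2) _ _) _.
rewrite ler_wpM2r ?powR_ge0 // ler_wpM2l ?(ltW c0) // ler_sqr ?nnegrE ?mulr_ge0 //.
exact: bs_lifted.
Qed.
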